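(* Let $Q$ be a stably Gelfand quantale, let $(I,A)$ be a $Q$-set, and let $S:I\to Q$ be an arbitrary mapping. The following statements are equivalent: 1. $S$ is a singleton of $(I,A)$; 2. $S^*$ is a Hilbert section of the Hilbert $Q$-module $Q^IA$. Moreover, letting $(\widehat I,\widehat A)$ be the completion of $(I,A)$ we have, for all $S,T\in\widehat I$, the equality $(\widehat A)_{ST}=\langle S^*,T^*\rangle$.
   Context: An involutive quantale is a sup-lattice (complete lattice) $Q$ with an associative multiplication preserving arbitrary joins in each variable and a join-preserving involution $a\mapsto a^*$ with $a^{**}=a$, $(ab)^*=b^*a^*$ (no unit is assumed). A stably Gelfand quantale is an involutive quantale $Q$ such that, for all $a\in Q$, $aa^*a\le a$ implies $aa^*a=a$. A projection is an element $q$ with $q=q^*=qq$. For $Q$-valued matrices, $(AB)_{\alpha\gamma}=\bigvee_\beta a_{\alpha\beta}b_{\beta\gamma}$ and $(A^* )_{\alpha\beta}=(a_{\beta\alpha})^*$; the order is entrywise. A $Q$-set is a set $I$ with a matrix $A:I\times I\to Q$ such that $A=A^*$ and $AA=A$. Singletons: a mapping $S:I\to Q$, with values $s_\alpha$, is regarded as a column matrix $I\times\{*\}\to Q$. It is a singleton of $(I,A)$ if there is a projection $q\in Q$ such that for all $\alpha,\beta\in I$: $s_\alpha=s_\alpha q$; $q\le\bigvee_{\gamma\in I}s_\gamma^*s_\gamma$; $s_\alpha=\bigvee_{\gamma\in I}a_{\alpha\gamma}s_\gamma$; and $s_\alpha s_\beta^*\le a_{\alpha\beta}$. The adjoint $S^*$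 is the row matrix with entries $s_\alpha^*$, also regarded as a mapping $I\to Q$. The completion $(\widehat I,\widehat A)$ of $(I,A)$ is the set $\widehat I$ of all singletons of $(I,A)$ with the matrix $(\widehat A)_{ST}=S^*T=\bigvee_{\alpha\in I}s_\alpha^*t_\alpha$. The Hilbert module $Q^IA$: $Q^I$ is the left $Q$-module of mappings $v:I\to Q$ with pointwise joins and left multiplication; for $v\in Q^I$, $vA\in Q^I$ is defined by $(vA)_\beta=\bigvee_{\alpha\in I}v_\alpha a_{\alpha\beta}$, and $Q^IA=\{vA\mid v\in Q^I\}$ is a submodule of $Q^I$, equipped with the $Q$-valued inner product $\langle v,w\rangle=\bigvee_{\alpha\in I}v_\alpha w_\alpha^*$. A Hilbert section of $Q^IA$ is an element $\sigma\in Q^IA$ such that $\langle x,\sigma\rangle\sigma\le x$ for all $x\in Q^IA$. *)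

(* Defs.v *)
Set Warnings "-notation-overridden".
From HB Require Import structures.
From mathcomp Require Import all_boot all_order.
From mathcomp Require Import boolp classical_sets.

Set Implicit Arguments.
Unset Strict Implicit.
Unset Printing Implicit Defensive.

Import Order.TTheory.

Local Open Scope classical_set_scope.
Local Open Scope order_scope.

(* The library's partial orders and semigroups are choiceTypes with a boolean
   order; with the classical axioms of boolp this is no restriction. *)

HB.mixin Record isSupLattice d T of Order.POrder d T := {
  bigjoin : set T -> T;
  bigjoin_isLub : forall X : set T, isLub X (bigjoin X)
}.

#[short(type="supLatticeType")]
HB.structure Definition SupLattice d :=
  {T of isSupLattice d T & Order.POrder d T}.

(* X may be empty in the two axioms below, so multiplication also preserves
   the bottom element; there is no unit. *)
HB.mixin Record isQuantale d Q of SupLattice d Q & Semigroup Q := {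
  mul_bigjoinl : forall (a : Q) (X : set Q),
    (bigjoin X * a)%g = bigjoin [set (x * a)%g | x in X];
  mul_bigjoinr : forall (a : Q) (X : set Q),
    (a * bigjoin X)%g = bigjoin [set (a * x)%g | x in X]
}.

#[short(type="quantaleType")]
HB.structure Definition Quantale d :=
  {Q of isQuantale d Q & SupLattice d Q & Semigroup Q}.

HB.mixin Record isInvolutiveQuantale d Q of Quantale d Q := {
  qstar : Q -> Q;
  qstarK : forall a : Q, qstar (qstar a) = a;
  qstarM : forall a b : Q, qstar (a * b)%g = (qstar b * qstar a)%g;
  qstar_bigjoin : forall X : set Q,
    qstar (bigjoin X) = bigjoin [set qstar x | x in X]
}.

#[short(type="involutiveQuantaleType")]
HB.structure Definition InvolutiveQuantale d :=
  {Q of isInvolutiveQuantale d Q & Quantale d Q}.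

Notation "a ^*" := (qstar a) : order_scope.

HB.mixin Record isStablyGelfand d Q of InvolutiveQuantale d Q := {
  stably_gelfand : forall a : Q, (a * a^* * a)%g <= a -> (a * a^* * a)%g = a
}.

#[short(type="stablyGelfandQuantaleType")]
HB.structure Definition StablyGelfandQuantale d :=
  {Q of isStablyGelfand d Q & InvolutiveQuantale d Q}.

Definition bigvee d (Q : supLatticeType d) (I : Type) (f : I -> Q) : Q :=
  bigjoin (range f).

Notation "\vee_ i F" := (bigvee (fun i => F%g))
  (at level 41, i at level 0, F at level 41, right associativity,
   format "\vee_ i  F") : order_scope.

Section Matrices.
Variables (d : Order.disp_t) (Q : involutiveQuantaleType d).

Definition projection (q : Q) : Prop := q = q^* /\ q = (q * q)%g.

Definition qmulmx (I J K : Type) (A : I -> J -> Q) (B : J -> K -> Q) :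
    I -> K -> Q :=
  fun i k => \vee_j (A i j * B j k).

Definition qadjmx (I J : Type) (A : I -> J -> Q) : J -> I -> Q :=
  fun j i => (A i j)^*.

(* S^* for S : I -> Q: the adjoint of the column S is a row, which is again
   regarded as a mapping I -> Q. *)
Definition qadj (I : Type) (S : I -> Q) : I -> Q := fun i => (S i)^*.

Record qset := QSet {
  qset_sort :> Type;
  qset_mx : qset_sort -> qset_sort -> Q;
  qset_adj : qset_mx = qadjmx qset_mx;
  qset_idem : qmulmx qset_mx qset_mx = qset_mx
}.

Definition is_singleton (X : qset) (S : X -> Q) : Prop :=
  exists2 q : Q, projection q &
    [/\ forall i, S i = (S i * q)%g,
        q <= \vee_i ((S i)^* * S i),
        forall i, S i = \vee_j (qset_mx i j * S j) &
        forall i j, (S i * (S j)^*)%g <= qset_mx i j].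

Definition singletons (X : qset) : Type := {S : X -> Q | is_singleton S}.

Definition completion_mx (X : qset) : singletons X -> singletons X -> Q :=
  fun S T => \vee_i ((sval S i)^* * sval T i).

End Matrices.

Section CompletionIsQSet.
Variables (d : Order.disp_t) (Q : involutiveQuantaleType d).
Implicit Types (a b c : Q).

Lemma bigvee_ub (I : Type) (f : I -> Q) i : f i <= bigvee f.
Proof. by have [ub _] := bigjoin_isLub (range f); apply: ub; exists i. Qed.

Lemma bigvee_le (I : Type) (f : I -> Q) b :
  (forall i, f i <= b) -> bigvee f <= b.
Proof.
move=> fb; have [_ lub] := bigjoin_isLub (range f).
by apply: lub => _ [i _ <-].
Qed.

Lemma bigveeMl (I : Type) (f : I -> Q) a :
  (bigvee f * a)%g = \vee_i (f i * a).
Proof. by rewrite /bigvee mul_bigjoinl image_comp. Qed.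

Lemma bigveeMr (I : Type) (f : I -> Q) a :
  (a * bigvee f)%g = \vee_i (a * f i).
Proof. by rewrite /bigvee mul_bigjoinr image_comp. Qed.

Lemma qstar_bigvee (I : Type) (f : I -> Q) : (bigvee f)^* = \vee_i (f i)^*.
Proof. by rewrite /bigvee qstar_bigjoin image_comp. Qed.

Lemma bigjoin_pair a b : a <= b -> bigjoin [set a; b] = b.
Proof.
move=> ab; have [ub lub] := bigjoin_isLub [set a; b].
apply/le_anti/andP; split; last by apply: ub; right.
by apply: lub => _ [->|->].
Qed.

Lemma le_mull a b c : a <= b -> (c * a)%g <= (c * b)%g.
Proof.
move=> ab; rewrite -(bigjoin_pair ab) mul_bigjoinr.
have [ub _] := bigjoin_isLub [set (c * x)%g | x in [set a; b]].
by apply: ub; exists a => //; left.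
Qed.

Lemma le_mulr a b c : a <= b -> (a * c)%g <= (b * c)%g.
Proof.
move=> ab; rewrite -(bigjoin_pair ab) mul_bigjoinl.
have [ub _] := bigjoin_isLub [set (x * c)%g | x in [set a; b]].
by apply: ub; exists a => //; left.
Qed.

Lemma completion_mx_adj (X : qset Q) :
  completion_mx (X := X) = qadjmx (completion_mx (X := X)).
Proof.
apply/funext => S; apply/funext => T.
rewrite /qadjmx /completion_mx qstar_bigvee; congr bigvee.
by apply/funext => i; rewrite qstarM qstarK.
Qed.

Lemma completion_mx_idem (X : qset Q) :
  qmulmx (completion_mx (X := X)) (completion_mx (X := X)) =
  completion_mx (X := X).
Proof.
apply/funext => S; apply/funext => T; apply/le_anti/andP; split.
  apply: bigvee_le => U; have [q _ [_ _ _ UA]] := svalP U.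
  have [r _ [_ _ TE _]] := svalP T.
  rewrite /completion_mx bigveeMl; apply: bigvee_le => i.
  rewrite bigveeMr; apply: bigvee_le => j.
  apply: le_trans (bigvee_ub _ i).
  rewrite mulgA -(mulgA (sval S i)^*) -mulgA; apply: le_mull.
  rewrite [leRHS]TE; apply: le_trans (bigvee_ub _ j).
  exact/le_mulr/UA.
apply: bigvee_le => i.
have [q [qstarq _] [SE qS _ _]] := svalP S.
rewrite SE qstarM -qstarq; apply: le_trans (bigvee_ub _ S).
rewrite -mulgA; apply: le_trans (le_mulr _ qS) _.
by apply: le_mull; apply: (bigvee_ub (fun k => ((sval S k)^* * sval T k)%g) i).
Qed.

Definition completion (X : qset Q) : qset Q :=
  QSet (completion_mx_adj X) (completion_mx_idem X).

End CompletionIsQSet.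

Section HilbertModule.
Variables (d : Order.disp_t) (Q : involutiveQuantaleType d).

Definition inner (I : Type) (v w : I -> Q) : Q := \vee_i (v i * (w i)^*).

Definition qscale (I : Type) (a : Q) (v : I -> Q) : I -> Q :=
  fun i => (a * v i)%g.

Definition qvecmx (I : Type) (v : I -> Q) (A : I -> I -> Q) : I -> Q :=
  fun j => \vee_i (v i * A i j).

(* The carrier of the submodule Q^I A of Q^I. *)
Definition hilbert_module (X : qset Q) : set (X -> Q) :=
  [set qvecmx v (@qset_mx _ _ X) | v in [set: X -> Q]].

Definition hilbert_section (X : qset Q) (s : X -> Q) : Prop :=
  hilbert_module s /\
  forall x : X -> Q, hilbert_module x ->
    forall i, qscale (inner x s) s i <= x i.

End HilbertModule.

(* Main.v *)
Require Import Defs.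
From mathcomp Require Import all_boot all_order.
From mathcomp Require Import boolp classical_sets.

(** The vectors of [Q^I A] are exactly those fixed by [A], so that the condition
    [S = A S] on a singleton says that [S^*] lies in the module. The rows of [A]
    lie in it too, and [<row i of A, S^*> = (A S)_i = s_i]; hence the section
    inequality at the rows of [A] is the singleton inequality
    [s_i s_j^* <= a_ij], and it spreads from the rows to the whole module by
    linearity. This already accounts for every part of the equivalence except
    the projection, which must be recovered from a Hilbert section.

    It is [q = <S^*, S^*> = \vee_i s_i^* s_i]. The section inequality at [S^*]
    itself gives [q s_i^* <= s_i^*], hence [q q <= q] and
    [s_i s_i^* s_i <= s_i q <= s_i]. The stably Gelfand law turns these
    inequalities into the equalities [q q = q] and [s_i q = s_i]. *)

Set Implicit Arguments.
Unset Strict Implicit.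
Unset Printing Implicit Defensive.

Import Order.TTheory.

Local Open Scope classical_set_scope.
Local Open Scope order_scope.

Section HilbertModuleOfQSet.
Variables (d : Order.disp_t) (Q : involutiveQuantaleType d) (X : qset Q).
Local Notation A := (@qset_mx _ _ X).

Lemma qvecmxA (I : Type) (v : I -> Q) (B C : I -> I -> Q) :
  qvecmx (qvecmx v B) C = qvecmx v (qmulmx B C).
Proof.
apply/funext => k; apply/le_anti/andP; split; apply: bigvee_le => i.
  rewrite bigveeMl; apply: bigvee_le => j; rewrite -mulgA.
  apply: le_trans (bigvee_ub _ j); apply: le_mull.
  exact: (bigvee_ub (fun j => (B _ j * C j _)%g)).
rewrite bigveeMr; apply: bigvee_le => j; rewrite mulgA.
apply: le_trans (bigvee_ub _ j); apply: le_mulr.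
exact: (bigvee_ub (fun i => (v i * B i _)%g)).
Qed.

Lemma hilbert_moduleP (v : X -> Q) : hilbert_module v <-> qvecmx v A = v.
Proof.
by split=> [[w _ <-]|vA]; [rewrite qvecmxA qset_idem | exists v].
Qed.

Lemma hilbert_module_row (i : X) : hilbert_module (A i).
Proof. by apply/hilbert_moduleP; rewrite -[RHS](congr1 (@^~ i) (qset_idem X)). Qed.

Lemma qset_mxC (i j : X) : (A i j)^* = A j i.
Proof. by rewrite [in RHS]qset_adj. Qed.

(** Because [A] is its own adjoint, [S = A S] transposes to [S^* = S^* A]. *)
Lemma hilbert_module_adj (S : X -> Q) :
  hilbert_module (qadj S) <-> forall i, S i = \vee_j (A i j * S j).
Proof.
have SAE i : qvecmx (qadj S) A i = (\vee_j (A i j * S j))^*.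
  rewrite qstar_bigvee; congr bigvee; apply/funext => j.
  by rewrite qstarM qset_mxC.
split=> [/hilbert_moduleP SA i|SA].
  by rewrite -[LHS]qstarK -[RHS]qstarK -SAE SA.
by apply/hilbert_moduleP/funext => i; rewrite SAE -SA.
Qed.

Lemma inner_adj (I : Type) (v S : I -> Q) :
  inner v (qadj S) = \vee_i (v i * S i).
Proof. by congr bigvee; apply/funext => i; rewrite qstarK. Qed.

(** Being a Hilbert section need only be tested on the rows of [A], which
    generate the module; there it reads [s_i s_j^* <= a_ij]. *)
Lemma hilbert_section_adj (S : X -> Q) :
  hilbert_section (qadj S) <->
  (forall i, S i = \vee_j (A i j * S j)) /\
  (forall i j, (S i * (S j)^*)%g <= A i j).
Proof.
split=> [[/hilbert_module_adj SA Ssec]|[SA SS]].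
  split=> // i j; have := Ssec _ (hilbert_module_row i) j.
  by rewrite /qscale inner_adj -SA.
split=> [|x /hilbert_moduleP xA i]; first exact/hilbert_module_adj.
rewrite -[leRHS](congr1 (@^~ i) xA) /qscale inner_adj bigveeMl.
apply: bigvee_le => j; apply: le_trans (bigvee_ub _ j).
by rewrite -mulgA; apply/le_mull/SS.
Qed.

Lemma inner_self_adj (I : Type) (v : I -> Q) : (inner v v)^* = inner v v.
Proof.
rewrite qstar_bigvee; congr bigvee; apply/funext => i.
by rewrite qstarM qstarK.
Qed.

Lemma qstar_le (a b : Q) : a <= b -> a^* <= b^*.
Proof.
move=> ab; rewrite -(bigjoin_pair ab) qstar_bigjoin.
have [ub _] := bigjoin_isLub [set qstar x | x in [set a; b]].
by apply: ub; exists a => //; left.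
Qed.

End HilbertModuleOfQSet.

(** The law makes a self-adjoint [q] with [q q <= q] regular, [q q q = q], so
    that [q = q q q <= q q]. *)
Lemma projection_of_mul_le d (Q : stablyGelfandQuantaleType d) (q : Q) :
  q^* = q -> (q * q)%g <= q -> projection q.
Proof.
move=> qC qq; split=> //; apply/le_anti/andP; split=> //.
have qqq : (q * q * q)%g <= q by apply: le_trans (le_mulr _ qq) qq.
rewrite -[leLHS](stably_gelfand q) qC //.
exact: le_mulr qq.
Qed.

Lemma hilbert_section_singleton d (Q : stablyGelfandQuantaleType d)
    (X : qset Q) (S : X -> Q) :
  hilbert_section (qadj S) -> is_singleton S.
Proof.
move=> Ssec; have [SA SS] := (hilbert_section_adj S).1 Ssec.
have [Smod Sle] := Ssec.
set q := inner (qadj S) (qadj S).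
have qE : q = \vee_i ((S i)^* * S i) by rewrite /q inner_adj.
have qC : q^* = q by apply: inner_self_adj.
have qS i : (q * (S i)^*)%g <= (S i)^* by apply: Sle.
have Sq i : (S i * q)%g <= S i.
  by rewrite -[leLHS]qstarK -[leRHS]qstarK qstarM qC; apply/qstar_le/qS.
have qq : (q * q)%g <= q.
  rewrite {2 3}qE bigveeMr; apply: bigvee_le => i.
  rewrite mulgA; apply: le_trans (le_mulr _ (qS i)) _.
  exact: (bigvee_ub (fun i => ((S i)^* * S i)%g)).
exists q; first exact: projection_of_mul_le.
split=> // [i|]; last by rewrite qE.
have SSq : (S i * (S i)^* * S i)%g <= (S i * q)%g.
  rewrite -mulgA qE; apply: le_mull.
  exact: (bigvee_ub (fun i => ((S i)^* * S i)%g)).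
apply/le_anti/andP; split=> //.
by rewrite -[leLHS](stably_gelfand (S i) (le_trans SSq (Sq i))).
Qed.

Theorem theorem6p21 (d : Order.disp_t) (Q : stablyGelfandQuantaleType d)
    (X : qset Q) :
  (forall S : X -> Q, is_singleton S <-> hilbert_section (qadj S)) /\
  (forall S T : completion X,
     qset_mx S T = inner (qadj (sval S)) (qadj (sval T))).
Proof.
split=> [S|S T]; last by rewrite inner_adj.
split=> [[q _ [_ _ SA SS]]|]; last exact: hilbert_section_singleton.
exact/hilbert_section_adj.
Qed.
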